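(* There is a function $f(\cdot,\cdot)$ such that, for every $\varepsilon>0$, every graph $G$ of highway dimension $\eta$, and every vertex $s$ of $G$, there exists a graph $H$ and an embedding $\phi$ of the vertices of $G$ into the vertices of $H$ such that $H$ has treewidth at most $f(\varepsilon,\eta)$, and for all vertices $u,v$ of $G$, $$d_G(u,v)\le d_H(\phi(u),\phi(v))\le d_G(u,v)+\varepsilon\big(d_G(s,u)+d_G(s,v)\big).$$
   Context: Graphs are undirected with positive edge lengths; $d_G(u,v)$ is the shortest-path distance in $G$ and $B_v(r)=\{u : d_G(u,v)\le r\}$. Fix a constant $c>4$. The highway dimension of $G$ is the smallest integer $\eta$ such that for every $r>0$ and every vertex $v$ there is a set of at most $\eta$ vertices in $B_v(cr)$ such that every shortest path contained in $B_v(cr)$ of length at least $r$ contains a vertex of this set. *)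

(* Defs.v *)
From HB Require Import structures.
From mathcomp Require Import all_boot all_order all_algebra.
From mathcomp Require Import all_classical all_reals all_analysis.

Set Implicit Arguments.
Unset Strict Implicit.
Unset Printing Implicit Defensive.

Import Order.TTheory GRing.Theory Num.Theory.
Local Open Scope ring_scope.

(* Only the values of [len] on edges are meaningful. *)
Record wgraph (R : realType) := WGraph {
  vert :> finType;
  edge : rel vert;
  len : vert -> vert -> R;
  edge_sym : symmetric edge;
  edge_irr : irreflexive edge;
  len_sym : forall u v, len u v = len v u;
  len_gt0 : forall u v, edge u v -> 0 < len u v
}.

Section Distance.
Variables (R : realType) (G : wgraph R).

(* As in path.v, the path x_0, ..., x_n is given by its first vertex x_0 and
   the sequence of the remaining ones. *)
Definition is_path (u v : G) (p : seq G) : bool :=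
  [&& path (@edge R G) u p, last u p == v & uniq (u :: p)].

Fixpoint path_len (u : G) (p : seq G) : R :=
  if p is v :: q then len u v + path_len v q else 0.

(* The infimum of the empty set is +oo, so vertices in different components are
   at distance +oo; otherwise the infimum is over a finite nonempty set. *)
Definition dist (u v : G) : \bar R :=
  ereal_inf [set (path_len u p)%:E | p in [set p | is_path u v p]]%classic.

Definition is_shortest_path (u v : G) (p : seq G) : Prop :=
  is_path u v p /\ (path_len u p)%:E = dist u v.

Definition gball (v : G) (r : R) : {set G} :=
  [set u : G | (dist u v <= r%:E)%E].

Definition highway_bound (c : R) (k : nat) : Prop :=
  forall (r : R) (v : G), 0 < r ->
  exists S : {set G},
    [/\ S \subset gball v (c * r),
        (#|S| <= k)%N &
        forall (x y : G) (p : seq G),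
          is_shortest_path x y p ->
          {subset x :: p <= gball v (c * r)} ->
          r <= path_len x p ->
          exists2 w, w \in S & w \in x :: p].

Lemma highway_bound_ex (c : R) : exists k, `[< highway_bound c k >].
Proof.
exists #|G|; apply/asboolP => r v _; exists (gball v (c * r)).
split; [exact: subxx | exact: max_card | move=> x y p _ sub _].
by exists x; rewrite ?mem_head// sub ?mem_head.
Qed.

Definition highway_dim (c : R) : nat := ex_minn (highway_bound_ex c).

End Distance.

Record is_tree (T : finType) (e : rel T) : Prop := IsTree {
  tree_sym : symmetric e;
  tree_irr : irreflexive e;
  tree_nonempty : (0 < #|T|)%N;
  tree_connected : forall x y, connect e x y;
  tree_acyclic : forall p : seq T, (2 < size p)%N -> ~ ucycle e p
}.

Section Treewidth.
Variables (R : realType) (G : wgraph R).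

Record is_tree_decomp (T : finType) (e : rel T) (bag : T -> {set G}) : Prop :=
  IsTreeDecomp {
    td_tree : is_tree e;
    td_vertex : forall v : G, exists t, v \in bag t;
    td_edge : forall u v : G, edge u v ->
      exists t, (u \in bag t) && (v \in bag t);
    td_subtree : forall (v : G) (t t' : T), v \in bag t -> v \in bag t' ->
      connect [rel a b | [&& e a b, v \in bag a & v \in bag b]] t t'
  }.

(* Truncated subtraction: the graph without vertices gets width 0, not -1. *)
Definition td_width (T : finType) (bag : T -> {set G}) : nat :=
  (\max_(t : T) #|bag t|).-1.

Definition has_td_width (k : nat) : Prop :=
  exists (T : finType) (e : rel T) (bag : T -> {set G}),
    is_tree_decomp e bag /\ td_width bag = k.

Lemma has_td_width_ex : exists k, `[< has_td_width k >].
Proof.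
exists (td_width (fun _ : unit => [set: G])); apply/asboolP.
exists unit, (fun _ _ => false), (fun=> [set: G]); split=> //; split.
- split=> //; first by rewrite card_unit.
  + by move=> [] []; exact: connect0.
  + move=> p ps /andP[_ /card_uniqP pE].
    by have := max_card (mem p); rewrite pE card_unit leqNgt (ltn_trans _ ps).
- by move=> v; exists tt; rewrite inE.
- by move=> u v _; exists tt; rewrite !inE.
- by move=> v [] [] _ _; exact: connect0.
Qed.

Definition treewidth : nat := ex_minn has_td_width_ex.

End Treewidth.

(* Main.v *)
Require Import Defs.
From HB Require Import structures.
From mathcomp Require Import all_boot all_order all_algebra.
From mathcomp Require Import all_classical all_reals all_analysis.
From mathcomp Require Import lra.

Set Implicit Arguments.
Unset Strict Implicit.
Unset Printing Implicit Defensive.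

Import Order.TTheory GRing.Theory Num.Theory.
Local Open Scope ring_scope.

(* Call an open ball of radius tau a town of scale tau if all of its points
   are centres of it; the towns avoiding a given vertex form a laminar
   family. Put lam = c / 4 > 1. Let S be the at most eta hubs that the
   highway dimension yields for the scale q/2 and the ball of radius 2 lam q
   around h. A vertex u within lam q of h lies in a town of scale q/2 or
   within q of S, and S hits every shortest path from u of length between q/2
   and lam q. Dividing the scale by lam repeatedly, around the hubs already
   found, gives for each ball of radius r a bounded set of portals through
   which all pairs of its vertices are joined up to a small multiple of r,
   except the pairs that lie in a common town of scale r/(2 lam) avoiding the
   centre.

   At level k, of scale sigma proportional to lam^k, let the vertices within
   about sigma of s form one class with centre s, and group the others into
   their maximal towns of scale at most 2 sigma avoiding s. These nested
   partitions form a tree. Each class carries the portals of its centre,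
   which serve the pairs separated at level k - 1. The distance to s varies
   by a factor of at most 2 on a town avoiding s, so the levels at which an
   error eps d(s, u) matters and d(s, u) is not negligible against sigma form
   a window of bounded length. Joining u to s and to copies of the portals of
   the classes of u inside this window gives H, and the tree of classes, with
   bags truncated to windows, is a tree decomposition of bounded width. *)

(** * Distances in weighted graphs *)

Section GraphDistance.
Variables (R : realType) (G : wgraph R).
Implicit Types (u v w : G) (p q : seq G).

Local Notation walk := (path (@edge R G)).

Lemma path_len_cat u p q :
  path_len u (p ++ q) = path_len u p + path_len (last u p) q.
Proof. by elim: p u => [|w p IH] u /=; rewrite ?add0r// IH addrA. Qed.

Lemma path_len_ge0 u p : walk u p -> 0 <= path_len u p.
Proof.
elim: p u => [//|w p IH] u /= /andP[euw pw].
by rewrite addr_ge0 ?IH// ltW// len_gt0.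
Qed.

Lemma exists_is_path_le u p : walk u p ->
  exists2 q, is_path u (last u p) q & path_len u q <= path_len u p.
Proof.
elim: p u => [|w p IH] u /=.
  by exists [::]; rewrite ?lexx// /is_path /= eqxx.
move=> /andP[euw /IH[q]]; rewrite /is_path => /and3P[pq /eqP lq uq] le_qp.
have [|u_nq] := boolP (u \in w :: q); last first.
  exists (w :: q); last by rewrite /= lerD2l.
  by apply/and3P; split; rewrite /= ?euw ?lq ?eqxx//; apply/andP.
rewrite inE => /predU1P[u_w|u_q]; first by rewrite u_w edge_irr in euw.
case/splitPr: u_q pq lq uq le_qp => q1 q2.
rewrite cat_path last_cat /= => /and3P[pq1 eq1 pq2] lq uq le_qp.
exists q2.
  rewrite pq2 lq eqxx /=.
  by move: uq => /andP[_]; rewrite cat_uniq => /and3P[_ _ /= ->].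
apply: (le_trans (y := path_len w p)); last by rewrite lerDr ltW// len_gt0.
apply: le_trans le_qp; rewrite path_len_cat /= addrA lerDr.
by rewrite addr_ge0 ?path_len_ge0// ltW// len_gt0.
Qed.

Lemma connect_common_source s u v :
  connect (@edge R G) s u -> connect (@edge R G) s v -> connect (@edge R G) u v.
Proof.
by rewrite (sym_connect_sym (@edge_sym R G)); exact: connect_trans.
Qed.

Lemma dist_le_walk u v p : walk u p -> last u p = v ->
  (dist u v <= (path_len u p)%:E)%E.
Proof.
move=> pp <-; have [q qp le_qp] := exists_is_path_le pp.
apply: (@le_trans _ _ (path_len u q)%:E); last by rewrite lee_fin.
by apply: ereal_inf_lbound; exists q.
Qed.

Lemma dist_le_edge u v : edge u v -> (dist u v <= (len u v)%:E)%E.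
Proof.
move=> uv; have := @dist_le_walk u v [:: v].
by rewrite /= uv addr0 => ->.
Qed.

Lemma le_dist (x : \bar R) u v :
  (forall p, walk u p -> last u p = v -> (x <= (path_len u p)%:E)%E) ->
  (x <= dist u v)%E.
Proof.
move=> xP; apply: le_ereal_inf_tmp => _ [p /and3P[pp /eqP lp _] <-].
exact: xP.
Qed.

Lemma dist_ge0 u v : (0 <= dist u v)%E.
Proof. by apply: le_dist => p pp _; rewrite lee_fin path_len_ge0. Qed.

Lemma dist_neqNy u v : dist u v != -oo%E.
Proof. by rewrite gt_eqF// (lt_le_trans _ (dist_ge0 _ _))// ltNyr. Qed.

Lemma distxx u : dist u u = 0%E.
Proof.
apply/eqP; rewrite eq_le dist_ge0 andbT.
exact: (@dist_le_walk u u [::]).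
Qed.

Lemma exists_reverse_walk u p : walk u p ->
  exists q, [/\ walk (last u p) q, last (last u p) q = u &
                path_len (last u p) q = path_len u p].
Proof.
elim: p u => [|w p IH] u /=; first by exists [::].
move=> /andP[euw /IH[q [pq lq len_q]]]; exists (rcons q u).
rewrite rcons_path pq lq edge_sym euw last_rcons -cats1 path_len_cat lq len_q.
by rewrite /= addr0 addrC len_sym.
Qed.

Lemma dist_sym u v : dist u v = dist v u.
Proof.
suff le_sym (a b : G) : (dist a b <= dist b a)%E.
  by apply/eqP; rewrite eq_le !le_sym.
apply: (@le_dist (dist a b) b a) => p pp lp; have [q] := exists_reverse_walk pp.
by rewrite lp => -[pq lq <-]; exact: dist_le_walk.
Qed.

Lemma dist_attained u v : connect (@edge R G) u v ->
  exists p, is_shortest_path u v p.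
Proof.
move=> /connectP[p0 /exists_is_path_le[q q_path _] vE].
rewrite -vE in q_path.
have size_path p : is_path u v p -> (size p <= #|G|)%N.
  move=> /and3P[_ _ /card_uniqP uE].
  by have := max_card (mem (u :: p)); rewrite uE; exact: ltnW.
pose q0 : {bseq #|G| of G} := Bseq (size_path _ q_path).
pose P (p : {bseq #|G| of G}) := is_path u v p.
case: (@arg_minP _ _ _ q0 P (fun p : {bseq #|G| of G} => path_len u p) q_path).
move=> p pP p_min; exists p; split=> //.
apply/eqP; rewrite eq_le; apply/andP; split.
  apply: le_ereal_inf_tmp => _ [r r_path <-]; rewrite lee_fin.
  exact: (p_min (Bseq (size_path _ r_path))).
by apply: ereal_inf_lbound; exists (p : seq G).
Qed.

Lemma dist_pinfty u v : ~~ connect (@edge R G) u v -> dist u v = +oo%E.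
Proof.
move=> n_uv; apply/eqP; rewrite -leye_eq; apply: le_dist => p pp lp.
by case/negP: n_uv; apply/connectP; exists p.
Qed.

Lemma dist_fin_numE u v : (dist u v \is a fin_num) = connect (@edge R G) u v.
Proof.
apply/idP/idP; first by apply: contraTT => /dist_pinfty ->.
by case/dist_attained => p [_ <-].
Qed.

Lemma dist_triangle u v w : (dist u w <= dist u v + dist v w)%E.
Proof.
have [uv|/dist_pinfty ->] := boolP (connect (@edge R G) u v); last first.
  by rewrite addye ?leey// dist_neqNy.
have [vw|/dist_pinfty ->] := boolP (connect (@edge R G) v w); last first.
  by rewrite addey ?leey// dist_neqNy.
have [p [/and3P[pp /eqP lp _] <-]] := dist_attained uv.
have [q [/and3P[pq /eqP lq _] <-]] := dist_attained vw.
rewrite -EFinD -{1}lp -path_len_cat; apply: dist_le_walk.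
  by rewrite cat_path pp lp.
by rewrite last_cat lp.
Qed.

Lemma dist_eq0 u v : dist u v = 0%E -> u = v.
Proof.
move=> uv0; have uv : connect (@edge R G) u v by rewrite -dist_fin_numE uv0.
have [[|w p] [/and3P[pp /eqP lp _] lenE]] := dist_attained uv; first exact: lp.
move: pp lenE; rewrite uv0 /= => /andP[euw pp] [] /eqP.
by rewrite gt_eqF// ltr_pwDl ?path_len_ge0// len_gt0.
Qed.

Lemma dist_shortest_path u v p w : is_shortest_path u v p -> w \in u :: p ->
  (dist u w + dist w v <= dist u v)%E.
Proof.
move=> [/and3P[pp /eqP lp _] <-]; rewrite inE => /predU1P[->|].
  by rewrite distxx add0e dist_le_walk.
move=> w_p; case/splitPr: w_p pp lp => p1 p2.
rewrite cat_path last_cat /= => /and3P[pp1 e1 pp2] lp.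
rewrite path_len_cat /= addrA EFinD; apply: leeD; last exact: dist_le_walk.
have <- : path_len u (rcons p1 w) = path_len u p1 + len (last u p1) w.
  by rewrite -cats1 path_len_cat /= addr0.
by apply: dist_le_walk; rewrite ?rcons_path ?pp1 ?last_rcons.
Qed.

(* Junk value: 0 between different components. *)
Definition fdist u v : R := fine (dist u v).

Lemma fdistE u v : connect (@edge R G) u v -> dist u v = (fdist u v)%:E.
Proof. by move=> uv; rewrite fineK// dist_fin_numE. Qed.

Lemma fdistC u v : fdist u v = fdist v u.
Proof. by rewrite /fdist dist_sym. Qed.

Lemma fdist_ge0 u v : 0 <= fdist u v.
Proof. exact/fine_ge0/dist_ge0. Qed.

Lemma fdist_gt0 u v : u != v -> connect (@edge R G) u v -> 0 < fdist u v.
Proof.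
move=> u_nv uv; rewrite -lte_fin -fdistE// lt_neqAle dist_ge0 andbT eq_sym.
by apply: contra u_nv => /eqP/dist_eq0 ->.
Qed.

End GraphDistance.

Lemma dist_le_map (R : realType) (H G : wgraph R) (f : H -> G) :
    (forall a b, edge a b -> (dist (f a) (f b) <= (len a b)%:E)%E) ->
  forall a b, (dist (f a) (f b) <= dist a b)%E.
Proof.
move=> f_edge a b; apply: le_dist => p + <-; elim: p a => [|w p IH] a /=.
  by rewrite distxx.
move=> /andP[/f_edge le_aw /IH le_p].
by rewrite EFinD; apply: le_trans (dist_triangle _ _ _) (leeD le_aw le_p).
Qed.

(** * Treewidth from a parent function *)

Record rooted_tree := RootedTree {
  node :> finType;
  parent : node -> node;
  apex : node;
  height : node -> nat;
  parent_apex : parent apex = apex;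
  height_parent : forall t, t != apex -> (height t < height (parent t))%N
}.

Section RootedTree.
Variable T : rooted_tree.
Implicit Types t a b : T.

Definition parent_edge : rel T :=
  [rel a b | (a != b) && ((parent a == b) || (parent b == a))].

Lemma parent_ind (P : T -> Prop) : P (apex T) ->
  (forall t, t != apex T -> P (parent t) -> P t) -> forall t, P t.
Proof.
move=> P_apex P_parent t; have [n] := ubnP (\max_(x : T) height x - height t).
elim: n t => // n IH t lt_n; have [->//|t_napex] := eqVneq t (apex T).
apply: P_parent => //; apply: IH; have lt_parent := height_parent t_napex.
rewrite -ltnS; apply: leq_trans lt_n; rewrite ltnS ltn_sub2l//.
by apply: leq_trans lt_parent _; exact: (@leq_bigmax _ (@height T) (parent t)).
Qed.

Lemma iter_parent_apex n : iter n (@parent T) (apex T) = apex T.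
Proof. by elim: n => //= n ->; exact: parent_apex. Qed.

Lemma parent_edge_sym : symmetric parent_edge.
Proof. by move=> a b; rewrite /parent_edge /= eq_sym orbC. Qed.

Lemma parent_edge_parent t : t != apex T -> parent_edge t (parent t).
Proof.
move=> /height_parent lt_parent; rewrite /parent_edge /= eqxx andbT.
by apply: contraTneq lt_parent => <-; rewrite ltnn.
Qed.

Lemma parent_edge_height a b :
  parent_edge a b -> (height a <= height b)%N -> b = parent a.
Proof.
move=> /andP[a_nb /predU1P[//|/eqP aE]] le_ab.
have [b_apex|/height_parent] := eqVneq b (apex T); last first.
  by rewrite aE ltnNge le_ab.
by move: a_nb; rewrite -aE b_apex parent_apex eqxx.
Qed.

(* On a cycle, a node of minimal height has its parent as both neighbours. *)
Lemma parent_edge_acyclic (p : seq T) :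
  (2 < size p)%N -> ~ ucycle parent_edge p.
Proof.
case: p => [//|x0 p0] size_p /andP[cyc_p uniq_p].
set p := x0 :: p0 in size_p cyc_p uniq_p *.
have x0_p : x0 \in p by rewrite mem_head.
case: (@arg_minnP _ x0 (fun x => x \in p) (@height T) x0_p) => x x_p x_min.
have next_p : next p x \in p by rewrite mem_next.
have prev_p : prev p x \in p by rewrite mem_prev.
have nextE : next p x = parent x.
  by apply: parent_edge_height (x_min _ next_p); exact: next_cycle.
have prevE : prev p x = parent x.
  apply: parent_edge_height (x_min _ prev_p); rewrite parent_edge_sym.
  exact: prev_cycle.
have [i q qE] := rot_to x_p.
have uniq_q : uniq (x :: q) by rewrite -qE rot_uniq.
have size_q : (2 < size (x :: q))%N by rewrite -qE size_rot.
move: nextE prevE; rewrite -(next_rot i uniq_p) -(prev_rot i uniq_p) qE.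
case: q uniq_q size_q {qE} => [//|y [//|z q]] uniq_q _ nextE prevE.
have : next [:: x, y, z & q] x = y by rewrite /= eqxx.
have : prev [:: x, y, z & q] x = last z q.
  rewrite prev_nth mem_head memNindex; last by case/andP: uniq_q.
  exact: (nth_last x [:: x, y, z & q]).
rewrite nextE prevE => -> yE; move: uniq_q => /= /and3P[_ /negP[]].
by rewrite -yE mem_last.
Qed.

Lemma parent_edge_tree : is_tree parent_edge.
Proof.
split.
- exact: parent_edge_sym.
- by move=> a; rewrite /parent_edge /= eqxx.
- by apply/card_gt0P; exists (apex T).
- have to_apex a : connect parent_edge a (apex T).
    elim/parent_ind: a => [|t t_napex]; first exact: connect0.
    exact/connect_trans/connect1/parent_edge_parent.
  move=> x y; apply: connect_trans (to_apex x) _.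
  by rewrite (sym_connect_sym parent_edge_sym).
- exact: parent_edge_acyclic.
Qed.

Section TreeDecomposition.
Variables (R : realType) (G : wgraph R) (bag : T -> {set G}) (top : G -> T).
Hypothesis mem_bag_top : forall v, v \in bag (top v).
Hypothesis mem_bag_parent : forall v t, v \in bag t -> t != top v ->
  t != apex T /\ v \in bag (parent t).

Lemma connect_in_bags v t t' : v \in bag t -> v \in bag t' ->
  connect [rel a b | [&& parent_edge a b, v \in bag a & v \in bag b]] t t'.
Proof.
set e := [rel a b | _] => vt vt'.
have e_sym : symmetric e.
  move=> a b; rewrite /e /= [parent_edge a b]parent_edge_sym.
  by rewrite [(v \in bag a) && _]andbC.
have to_top a : v \in bag a -> connect e a (top v).
  elim/parent_ind: a => [v_apex|a a_napex IH va].
    have [->|/(mem_bag_parent v_apex)[]] := eqVneq (apex T) (top v).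
      exact: connect0.
    by rewrite eqxx.
  have [->|/(mem_bag_parent va)[_ v_par]] := eqVneq a (top v).
    exact: connect0.
  apply: connect_trans (IH v_par); apply: connect1.
  by rewrite /e /= va v_par !andbT; exact: parent_edge_parent.
apply: connect_trans (to_top _ vt) _.
by rewrite (sym_connect_sym e_sym); exact: to_top.
Qed.

Lemma treewidth_le_bags (k : nat) :
    (forall u v : G, edge u v -> exists t, (u \in bag t) && (v \in bag t)) ->
    (forall t, (#|bag t| <= k.+1)%N) ->
  (treewidth G <= k)%N.
Proof.
move=> bag_edge bag_card; apply: (@leq_trans (td_width bag)); last first.
  by rewrite /td_width -subn1 leq_subLR add1n; apply/bigmax_leqP => t _.
rewrite /treewidth; case: ex_minnP => n _; apply; apply/asboolP.
exists T, parent_edge, bag; split=> //; split=> //.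
- exact: parent_edge_tree.
- by move=> v; exists (top v).
- exact: connect_in_bags.
Qed.

End TreeDecomposition.

Section Window.
Variables (N K : nat).

Definition window t : {set T * 'I_N} :=
  [set (iter jl.1 (@parent T) t, jl.2) | jl : 'I_K * 'I_N].

Lemma windowP t w :
  reflect (exists2 j, (j < K)%N & iter j (@parent T) t = w.1) (w \in window t).
Proof.
apply: (iffP imsetP) => [[[j l] _ -> /=]|[j lt_j jE]]; first by exists j.
by exists (Ordinal lt_j, w.2); rewrite //= jE -surjective_pairing.
Qed.

Lemma card_window t : (#|window t| <= K * N)%N.
Proof. by rewrite (leq_trans (leq_imset_card _ _))// card_prod !card_ord. Qed.

Lemma window_parent t w : w \in window t -> w.1 != t ->
  t != apex T /\ w \in window (parent t).
Proof.
move=> /windowP[[|j] lt_j jE] w_nt; first by rewrite -jE eqxx in w_nt.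
split; first by apply: contra w_nt => /eqP tE; rewrite -jE tE iter_parent_apex.
by apply/windowP; exists j; rewrite ?(ltnW lt_j)// -iterSr.
Qed.

End Window.

Section AttachLeaves.
Variables (V : finType) (leaf : V -> T).

Definition attach_parent (t : T + V) : T + V :=
  match t with inl t => inl (parent t) | inr v => inl (leaf v) end.

Definition attach_height (t : T + V) : nat :=
  match t with inl t => (height t).+1 | inr _ => 0%N end.

Lemma attach_parent_apex : attach_parent (inl (apex T)) = inl (apex T).
Proof. by rewrite /= parent_apex. Qed.

Lemma attach_height_parent (t : T + V) : t != inl (apex T) ->
  (attach_height t < attach_height (attach_parent t))%N.
Proof.
by case: t => [t|v] //= t_napex; rewrite ltnS height_parent.
Qed.

Definition attach_leaves : rooted_tree :=
  RootedTree attach_parent_apex attach_height_parent.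

End AttachLeaves.

End RootedTree.

Section LevelTree.
Variables (X : finType) (M : nat) (rep : nat -> X -> X).

Definition level_node (k : nat) (u : X) : option ('I_M * X) :=
  omap (fun i => (i, rep k u)) (insub k).

Definition level_parent (t : option ('I_M * X)) : option ('I_M * X) :=
  if t is Some (i, x) then level_node i.+1 x else None.

Definition level_height (t : option ('I_M * X)) : nat :=
  if t is Some (i, _) then i else M.

Lemma level_height_parent t : t != None ->
  (level_height t < level_height (level_parent t))%N.
Proof.
case: t => [[i x]|//] _ /=; rewrite /level_node.
by case: insubP => [j _ /= ->|_] //=.
Qed.

Definition level_tree : rooted_tree :=
  RootedTree (erefl None) level_height_parent.

Lemma level_nodeE k u (lt_k : (k < M)%N) :
  level_node k u = Some (Ordinal lt_k, rep k u).
Proof. by rewrite /level_node insubT. Qed.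

Hypothesis repS : forall k u, rep k.+1 (rep k u) = rep k.+1 u.

Lemma level_parent_node k u : level_parent (level_node k u) = level_node k.+1 u.
Proof.
rewrite {1}/level_node; case: insubP => [i _ iE|] /=.
  by rewrite iE /level_node repS.
by rewrite -leqNgt => le_Mk; rewrite /level_node insubN// -leqNgt leqW.
Qed.

Lemma iter_level_parent j k u :
  iter j level_parent (level_node k u) = level_node (j + k) u.
Proof. by elim: j => //= j ->; rewrite level_parent_node. Qed.

Lemma rep_le i j u v : (i <= j)%N -> rep i u = rep i v -> rep j u = rep j v.
Proof.
move=> /subnK <-; elim: (j - i)%N => //= n IH /IH eq_uv.
by rewrite addSn -repS eq_uv repS.
Qed.

End LevelTree.

(** * Towns and portals in a pseudometric *)

Record pseudometric (R : realFieldType) (X : Type) (d : X -> X -> R) : Prop :=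
  Pseudometric {
    pseudometricxx : forall x, d x x = 0;
    pseudometricC : forall x y, d x y = d y x;
    pseudometric_triangle : forall x y z, d x z <= d x y + d y z
  }.

Section Pseudometric.
Variables (R : realFieldType) (X : Type) (d : X -> X -> R).

Definition between (u v p : X) : Prop := d u p + d p v = d u v.

Definition detour (err : R) (u v p : X) : Prop := d u p + d p v <= d u v + err.

(* Every point of the open ball of radius tau around u is a centre of it: the
   ball has diameter < tau and lies at distance >= tau from its complement. *)
Definition town (tau : R) (u : X) : Prop :=
  forall v w, d u v < tau -> (d v w < tau) = (d u w < tau).

Definition same_town (s : X) (sigma : R) (u v : X) : Prop := u = v \/
  exists tau, [/\ tau <= sigma, town tau u, d u v < tau & tau <= d u s].

Hypothesis d_pm : pseudometric d.

Let dxx : forall x, d x x = 0 := pseudometricxx d_pm.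
Let dC : forall x y, d x y = d y x := pseudometricC d_pm.
Let d_triangle : forall x y z, d x z <= d x y + d y z :=
  pseudometric_triangle d_pm.

Lemma pseudometric_ge0 x y : 0 <= d x y.
Proof. by have := d_triangle x y x; rewrite dxx (dC y x); lra. Qed.

Lemma detour_sym err u v p : detour err u v p -> detour err v u p.
Proof. by rewrite /detour addrC dC (dC u p) (dC v u). Qed.

Lemma town_move tau u v : town tau u -> d u v < tau -> town tau v.
Proof.
by move=> u_town uv w x vw; rewrite !(u_town v)// (u_town w)// -(u_town v).
Qed.

Section SameTown.
Variable s : X.

Lemma same_town_sym sigma u v : same_town s sigma u v -> same_town s sigma v u.
Proof.
move=> [->|[tau [le_tau u_town uv us]]]; [by left|right; exists tau].
split=> //; first exact: town_move uv.
- by rewrite dC.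
- by rewrite leNgt (u_town v s uv) -leNgt.
Qed.

Lemma same_town_trans sigma v u w :
  same_town s sigma u v -> same_town s sigma v w -> same_town s sigma u w.
Proof.
move=> [->//|[tau [le_tau u_town uv us]]] [<-|[tau' [le_tau' v_town vw vs]]].
  by right; exists tau.
right; have [le_tt|/ltW le_tt] := leP tau tau'.
  have vu : d v u < tau' by rewrite dC; apply: lt_le_trans le_tt.
  exists tau'; split=> //; first exact: town_move vu.
    by rewrite (v_town u w vu).
  by rewrite leNgt (v_town u s vu) -leNgt.
exists tau; split=> //; rewrite -(u_town v w uv).
exact: lt_le_trans le_tt.
Qed.

Lemma same_town_le sigma sigma' u v : sigma <= sigma' ->
  same_town s sigma u v -> same_town s sigma' u v.
Proof.
move=> le_s [->|[tau [le_tau u_town uv us]]]; [by left|right; exists tau].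
by split=> //; apply: le_trans le_s.
Qed.

Lemma same_town_lt sigma u v :
  0 < sigma -> same_town s sigma u v -> d u v < sigma.
Proof.
move=> sigma_gt0 [<-|[tau [le_tau _ uv _]]]; first by rewrite dxx.
exact: lt_le_trans le_tau.
Qed.

Lemma same_town_dist_le sigma u v : same_town s sigma u v -> d s u <= 2 * d s v.
Proof.
move=> /same_town_sym[->|[tau [_ _ vu vs]]].
  by have := pseudometric_ge0 s u; lra.
by have := d_triangle s v u; rewrite (dC s v); lra.
Qed.

Lemma same_town_recentre sigma sigma' x u v :
  same_town s sigma' u x -> same_town x sigma u v -> same_town s sigma u v.
Proof.
move=> ux [->|[tau [le_tau u_town uv le_ux]]]; [by left|right; exists tau].
split=> //; case: ux => [ux|[tau' [_ _ ux us]]]; last by lra.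
by move: le_ux; rewrite -ux dxx; have := pseudometric_ge0 u v; lra.
Qed.

End SameTown.

End Pseudometric.

Lemma card_bigcup_le (I T : finType) (A : {set I}) (F : I -> {set T}) n :
    (forall i, i \in A -> (#|F i| <= n)%N) ->
  (#|\bigcup_(i in A) F i| <= #|A| * n)%N.
Proof.
move=> F_le; rewrite -cover_imset (leq_trans (leq_card_cover _))//.
apply: (@leq_trans (\sum_(B in F @: A) n)).
  by apply: leq_sum => _ /imsetP[i iA ->]; exact: F_le.
by rewrite sum_nat_const leq_mul2r leq_imset_card orbT.
Qed.

Lemma exists_ord_enum (T : finType) (A : {set T}) (x0 : T) n : (#|A| <= n)%N ->
  exists f : 'I_n -> T, {in A, forall x, exists i, f i = x}.
Proof.
move=> A_le; exists (fun i => nth x0 (enum A) i) => x xA.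
have lt_n : (index x (enum A) < n)%N.
  by apply: leq_trans A_le; rewrite cardE index_mem mem_enum.
by exists (Ordinal lt_n); rewrite /= nth_index// mem_enum.
Qed.

Section Hubs.
Variables (R : realFieldType) (X : finType) (d : X -> X -> R).
Implicit Types S Q : {set X}.

Definition hubs (c : R) (h : X) (r : R) (S : {set X}) : Prop :=
  forall u v, r <= d u v -> (forall z, between d u v z -> d z h <= c * r) ->
  exists2 w, w \in S & between d u v w.

Definition hub_bound (c : R) (eta : nat) : Prop := forall h r, 0 < r ->
  exists2 S : {set X}, (#|S| <= eta)%N & hubs c h r S.

Hypothesis d_pm : pseudometric d.

Let dC : forall x y, d x y = d y x := pseudometricC d_pm.
Let d_triangle : forall x y z, d x z <= d x y + d y z :=
  pseudometric_triangle d_pm.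
Let d_ge0 : forall x y, 0 <= d x y := pseudometric_ge0 d_pm.

Variables (eta : nat) (lam : R).
Hypothesis lam_gt1 : 1 < lam.

Section HubSet.
Variables (h : X) (q : R) (S : {set X}).
Hypothesis S_hubs : hubs (4 * lam) h (q / 2) S.

Lemma hubs_between u v :
    d u h <= lam * q -> q / 2 <= d u v -> d u v <= lam * q ->
  exists2 w, w \in S & between d u v w.
Proof.
move=> uh le_uv uv; apply: S_hubs => // z; rewrite /between => uvz.
by have := d_triangle z u h; rewrite (dC z u); have := d_ge0 z v; lra.
Qed.

Lemma hubs_town u : 0 < q -> d u h <= lam * q ->
  (forall w, w \in S -> q < d u w) -> town d (q / 2) u.
Proof.
move=> q_gt0 uh far; have lt_q : q < lam * q by rewrite ltr_pMl.
have gap b : q / 2 <= d u b -> q < d u b.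
  move=> le_ub; rewrite ltNge; apply/negP => ub.
  have [|w /far + wE] := hubs_between uh le_ub; first by lra.
  by have := d_ge0 w b; move: wE; rewrite /between; lra.
move=> a b ua; have [ub|/gap ub] := ltP (d u b) (q / 2); last first.
  by apply/negbTE; rewrite -leNgt; have := d_triangle u a b; lra.
rewrite ltNge; apply/negP => le_ab.
have ab : d a b < q by have := d_triangle a u b; rewrite (dC a u); lra.
have near_u z : between d a b z -> d u z < q.
  have := d_triangle u a z; have := d_triangle u b z.
  by rewrite /between (dC b z); lra.
have [z /near_u uz|w /far + /near_u] := S_hubs le_ab; last by lra.
by have := d_triangle z u h; rewrite (dC z u); lra.
Qed.

End HubSet.

Definition portal_cover (x : X) (r sigma q : R) (Q : {set X}) : Prop :=
  forall u v, d x u <= r -> d u v <= r ->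
  [\/ exists2 p, p \in Q & between d u v p, same_town d x sigma u v |
      d u v <= q /\ exists2 h, h \in Q & d u h <= q].

Hypothesis d_hubs : hub_bound (4 * lam) eta.

Lemma portal_cover_refine x r sigma q Q :
    0 < q -> q / 2 <= sigma -> x \in Q -> portal_cover x r sigma (lam * q) Q ->
  exists Q', [/\ (#|Q'| <= eta.+1 * #|Q|)%N, x \in Q' &
                 portal_cover x r sigma q Q'].
Proof.
move=> q_gt0 le_sigma xQ Q_cover; have q2_gt0 : 0 < q / 2 by lra.
have /choice[S SP] h : exists S,
    (#|S| <= eta)%N /\ hubs (4 * lam) h (q / 2) S.
  by have [S ? ?] := d_hubs h q2_gt0; exists S.
exists (Q :|: \bigcup_(h in Q) S h); split=> [||u v xu uv].
- rewrite (leq_trans (leq_card_setU _ _))// mulSn leq_add// mulnC.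
  by apply: card_bigcup_le => h _; case: (SP h).
- by rewrite inE xQ.
have Q_sub p : p \in Q -> p \in Q :|: \bigcup_(h in Q) S h by rewrite inE => ->.
have [[p pQ pE]||[uvq [h hQ uh]]] := Q_cover u v xu uv.
- by apply: Or31; exists p; rewrite ?Q_sub.
- exact: Or32.
have S_sub w : w \in S h -> w \in Q :|: \bigcup_(h in Q) S h.
  by move=> wS; rewrite inE; apply/orP; right; apply/bigcupP; exists h.
have [_ S_hubs] := SP h; have [le_uv|lt_uv] := leP (q / 2) (d u v).
  have [w wS wE] := hubs_between S_hubs uh le_uv uvq.
  by apply: Or31; exists w; rewrite ?S_sub.
have [[w wS uw]|far] := pselect (exists2 w, w \in S h & d u w <= q).
  by apply: Or33; split; [lra|exists w; rewrite ?S_sub].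
have [le_ux|lt_ux] := leP (q / 2) (d u x); last first.
  by apply: Or33; split; [lra|exists x; rewrite ?Q_sub//; lra].
apply: Or32; right; exists (q / 2); split=> //.
apply: (hubs_town S_hubs q_gt0 uh) => w wS; rewrite ltNge.
by apply/negP => uw; apply: far; exists w.
Qed.

Lemma exists_portal_cover J x r : 0 < r -> exists Q,
  [/\ (#|Q| <= eta.+1 ^ J)%N, x \in Q &
      portal_cover x r (r / lam / 2) (r / lam ^+ J) Q].
Proof.
move=> r_gt0; have lam_gt0 : 0 < lam by apply: lt_trans lam_gt1.
elim: J => [|J [Q [Q_le xQ Q_cover]]].
  exists [set x]; split=> [||u v xu uv]; rewrite ?cards1 ?inE//.
  by apply: Or33; rewrite expr0 divr1; split=> //; exists x; rewrite ?inE// dC.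
pose q := r / lam ^+ J.+1.
have q_gt0 : 0 < q by rewrite divr_gt0// exprn_gt0.
have q_le : q / 2 <= r / lam / 2.
  rewrite ler_pM2r ?invr_gt0// ler_pM2l// lef_pV2 ?posrE ?exprn_gt0//.
  by rewrite exprS ler_peMr ?exprn_ege1 ?ltW.
have qE : r / lam ^+ J = lam * q.
  by rewrite /q exprS invfM mulrCA mulVKf// gt_eqF.
rewrite qE in Q_cover.
have [Q' [Q'_le xQ' Q'_cover]] := portal_cover_refine q_gt0 q_le xQ Q_cover.
exists Q'; split=> //; rewrite (leq_trans Q'_le)// expnS.
by rewrite leq_mul2l Q_le orbT.
Qed.

Lemma exists_portals J x r : 0 < r -> exists Q : 'I_(eta.+1 ^ J) -> X,
  (exists l, Q l = x) /\
  forall u v, d x u <= r -> d u v <= r ->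
    same_town d x (r / lam / 2) u v \/
    exists l, detour d (2 * (r / lam ^+ J)) u v (Q l).
Proof.
move=> r_gt0; have [A [A_le xA A_cover]] := exists_portal_cover J x r_gt0.
have [Q QP] := exists_ord_enum x A_le; exists Q; split=> [|u v xu uv].
  exact: QP.
have q_gt0 : 0 < r / lam ^+ J.
  by rewrite divr_gt0// exprn_gt0// (lt_trans _ lam_gt1).
rewrite /detour.
have [[p /QP[l <-]]||[_ [h /QP[l <-] uh]]] := A_cover u v xu uv.
- by rewrite /between => lE; right; exists l; lra.
- by left.
- right; exists l; have := d_triangle (Q l) u v; rewrite (dC (Q l) u); lra.
Qed.

End Hubs.

(** * The hierarchy of towns around a vertex *)

Section TruncLog.
Variable R : realType.
Implicit Types lam x : R.

Definition trunc_logr lam x : nat := Num.truncn (ln x / ln lam).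

Lemma trunc_logr_ltn lam x : 1 < lam -> x < lam ^+ (trunc_logr lam x).+1.
Proof.
move=> lam_gt1; have lam_gt0 := lt_trans ltr01 lam_gt1.
have [x_le0|x_gt0] := leP x 0; first by rewrite (le_lt_trans x_le0)// exprn_gt0.
rewrite -ltr_ln ?posrE ?exprn_gt0// lnXn// -mulr_natl -ltr_pdivrMr ?ln_gt0//.
exact: truncnS_gt.
Qed.

Lemma trunc_logrP lam x : 1 < lam -> 1 <= x -> lam ^+ trunc_logr lam x <= x.
Proof.
move=> lam_gt1 x_ge1; have lam_gt0 := lt_trans ltr01 lam_gt1.
have x_gt0 := lt_le_trans ltr01 x_ge1.
rewrite -ler_ln ?posrE ?exprn_gt0// lnXn// -mulr_natl -ler_pdivlMr ?ln_gt0//.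
by rewrite truncn_le divr_ge0 ?ln_ge0// ltW.
Qed.

End TruncLog.

Section TownDistance.
Variables (R : realFieldType) (X : finType) (d : X -> X -> R) (s : X).

Definition town_rep (sigma : R) (u : X) : X :=
  odflt u [pick v | `[< same_town d s sigma u v >]].

(* An upper bound for the scales of the towns that avoid s. *)
Definition total_dist : R := \sum_v d s v.

Definition town_dist (u : X) : R := d s (town_rep total_dist u).

Hypothesis d_pm : pseudometric d.

Lemma town_rep_same sigma u : same_town d s sigma u (town_rep sigma u).
Proof. by rewrite /town_rep; case: pickP => [v /asboolP//|_]; left. Qed.

Lemma town_rep_eq sigma u v :
  same_town d s sigma u v -> town_rep sigma u = town_rep sigma v.
Proof.
move=> uv; rewrite /town_rep.
have -> : [pick w | `[< same_town d s sigma u w >]] =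
          [pick w | `[< same_town d s sigma v w >]].
  apply: eq_pick => w; apply/asboolP/asboolP; apply: same_town_trans => //.
  exact: same_town_sym.
by case: pickP => [//|/(_ v)/asboolP[]]; left.
Qed.

Lemma dist_le_total u : d s u <= total_dist.
Proof.
rewrite /total_dist (bigD1 u)//= lerDl; apply: sumr_ge0 => v _.
exact: pseudometric_ge0.
Qed.

Lemma town_dist_same sigma u v :
  same_town d s sigma u v -> town_dist u = town_dist v.
Proof.
move=> uv; congr (d s _); apply: town_rep_eq.
case: uv => [->|[tau [_ u_town uv us]]]; [by left|right; exists tau].
by split=> //; rewrite (le_trans us)// (pseudometricC d_pm) dist_le_total.
Qed.

Lemma town_dist_le u : town_dist u <= 2 * d s u.
Proof.
exact: (same_town_dist_le d_pm (same_town_sym d_pm (town_rep_same _ _))).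
Qed.

Lemma le_town_dist u : d s u <= 2 * town_dist u.
Proof. exact: (same_town_dist_le d_pm (town_rep_same _ u)). Qed.

Lemma town_dist_ge0 u : 0 <= town_dist u.
Proof. exact: pseudometric_ge0. Qed.

Lemma town_distss : town_dist s = 0.
Proof.
have := town_dist_le s; have := town_dist_ge0 s.
by rewrite (pseudometricxx d_pm); lra.
Qed.

End TownDistance.

Definition routed (R : realFieldType) (X : Type) (d : X -> X -> R) (s : X)
    (eps : R) (T : rooted_tree) (N K : nat) (leaf : X -> T)
    (Q : T * 'I_N -> X) (u v : X) : Prop :=
  let err := eps * (d s u + d s v) in
  detour d err u v s \/
  exists w, [/\ w \in window N K (leaf u), w \in window N K (leaf v) &
                detour d err u v (Q w)].

Section Hierarchy.
Variables (R : realType) (X : finType) (d : X -> X -> R) (eta : nat).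
Variables (lam eps : R) (J K : nat) (s : X).
Hypotheses (d_pm : pseudometric d) (d_gt0 : forall u, u != s -> 0 < d s u).
Hypotheses (lam_gt1 : 1 < lam) (d_hubs : hub_bound d (4 * lam) eta).
Hypotheses (eps_gt0 : 0 < eps) (eps_le1 : eps <= 1).
Hypothesis J_large : 16 * lam <= eps * lam ^+ J.
Hypothesis K_large : 64 * lam ^+ 2 <= eps ^+ 2 * lam ^+ K.

Let dC : forall x y, d x y = d y x := pseudometricC d_pm.
Let d_triangle : forall x y z, d x z <= d x y + d y z :=
  pseudometric_triangle d_pm.
Let d_ge0 : forall x y, 0 <= d x y := pseudometric_ge0 d_pm.
Let lam_gt0 : 0 < lam := lt_trans ltr01 lam_gt1.

Local Notation N := (eta.+1 ^ J)%N.
Local Notation town_dist := (town_dist d s).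

Definition min_dist : R := \big[Num.min/1]_(u | u != s) town_dist u.

Lemma min_dist_gt0 : 0 < min_dist.
Proof.
apply/bigmin_gtP; split=> // u /d_gt0.
by have := le_town_dist s d_pm u; lra.
Qed.

Lemma min_dist_le u : u != s -> min_dist <= town_dist u.
Proof. by move=> u_ns; apply: bigmin_le_cond. Qed.

Definition scale (k : nat) : R := eps / 8 * min_dist * lam ^+ k.

Lemma scale_gt0 k : 0 < scale k.
Proof. by rewrite !mulr_gt0 ?exprn_gt0 ?min_dist_gt0. Qed.

Lemma scaleE k : 8 * scale k = eps * (min_dist * lam ^+ k).
Proof. by rewrite /scale; lra. Qed.

Lemma scaleS k : scale k.+1 = lam * scale k.
Proof. by rewrite /scale exprS mulrCA. Qed.

Lemma scale_le i j : (i <= j)%N -> scale i <= scale j.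
Proof.
move=> ij; rewrite ler_pM2l ?ler_weXn2l ?ltW//.
by rewrite !mulr_gt0// min_dist_gt0.
Qed.

Lemma scale_ltn i j : scale i < scale j -> (i < j)%N.
Proof. by apply: contraTltn => /scale_le; rewrite leNgt. Qed.

Definition top_level : nat :=
  (trunc_logr lam (total_dist d s / (eps / 8 * min_dist))).+1.

Lemma town_dist_le_top u : town_dist u <= scale top_level.
Proof.
apply: le_trans (dist_le_total s d_pm _) _; rewrite /scale mulrC -ler_pdivrMr.
  by rewrite ltW// trunc_logr_ltn.
by rewrite !mulr_gt0// min_dist_gt0.
Qed.

Definition centre (k : nat) (u : X) : X :=
  if town_dist u <= scale k then s else town_rep d s (2 * scale k) u.

Lemma centre_near k u : town_dist u <= scale k -> centre k u = s.
Proof. by rewrite /centre => ->. Qed.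

Lemma centre_far k u : scale k < town_dist u ->
  same_town d s (2 * scale k) u (centre k u).
Proof. by rewrite /centre leNgt => -> /=; exact: town_rep_same. Qed.

Lemma centre_same k u v :
  same_town d s (2 * scale k) u v -> centre k u = centre k v.
Proof.
by move=> uv; rewrite /centre (town_dist_same d_pm uv) (town_rep_eq d_pm uv).
Qed.

Lemma centreS k u : centre k.+1 (centre k u) = centre k.+1 u.
Proof.
have le_scale := scale_le (leqnSn k).
have [u_near|u_far] := leP (town_dist u) (scale k).
  rewrite (centre_near u_near) !centre_near ?(le_trans u_near)//.
  by rewrite town_distss// ltW// scale_gt0.
apply/esym/centre_same; apply: same_town_le (centre_far u_far).
by rewrite ler_pM2l.
Qed.

Lemma centre_eq_far k u v : scale k < town_dist u -> centre k u = centre k v ->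
  same_town d s (2 * scale k) u v /\ scale k < town_dist v.
Proof.
move=> u_far eq_uv; have u_town := centre_far u_far.
have [v_near|v_far] := leP (town_dist v) (scale k).
  move: u_town u_far; rewrite eq_uv centre_near// => /(town_dist_same d_pm) ->.
  by rewrite town_distss// ltNge ltW ?scale_gt0.
split=> //; apply: same_town_trans u_town _ => //; rewrite eq_uv.
by apply: same_town_sym => //; exact: centre_far.
Qed.

Lemma centre_dist_le k u : d (centre k u) u <= 2 * scale k.
Proof.
have [u_near|u_far] := leP (town_dist u) (scale k).
  by rewrite centre_near//; have := le_town_dist s d_pm u; lra.
rewrite dC ltW//; apply: same_town_lt (centre_far u_far) => //.
by rewrite mulr_gt0 ?scale_gt0.
Qed.

(* The first level at which an error eps d(s, u) matters. *)
Definition first_level (u : X) : nat := trunc_logr lam (town_dist u / min_dist).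

Lemma first_level_le u :
  u != s -> 8 * scale (first_level u) <= eps * town_dist u.
Proof.
move=> u_ns; have m_gt0 := min_dist_gt0.
have : lam ^+ first_level u <= town_dist u / min_dist.
  by apply: trunc_logrP => //; rewrite ler_pdivlMr// mul1r min_dist_le.
by rewrite scaleE ler_pM2l// ler_pdivlMr// mulrC.
Qed.

Lemma first_level_gt u : eps * town_dist u < 8 * (lam * scale (first_level u)).
Proof.
have m_gt0 := min_dist_gt0.
have : town_dist u / min_dist < lam ^+ (first_level u).+1.
  exact: trunc_logr_ltn.
by rewrite -scaleS scaleE ltr_pM2l// ltr_pdivrMr// mulrC.
Qed.

Lemma scale_first_level_lt u : u != s -> scale (first_level u) < town_dist u.
Proof.
move=> /first_level_le le_u; have := scale_gt0 (first_level u).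
have : eps * town_dist u <= town_dist u by rewrite ler_piMl// town_dist_ge0.
lra.
Qed.

Lemma first_level_eq u v : u != s ->
  centre (first_level u) u = centre (first_level u) v ->
  first_level u = first_level v.
Proof.
move=> /scale_first_level_lt u_far /(centre_eq_far u_far)[uv _].
by rewrite /first_level (town_dist_same d_pm uv).
Qed.

Lemma first_level_lt_top u : u != s -> (first_level u < top_level)%N.
Proof.
move=> /scale_first_level_lt lt_u; apply: scale_ltn.
exact: lt_le_trans (town_dist_le_top u).
Qed.

Lemma window_gt0 : (0 < K)%N.
Proof.
rewrite lt0n; apply: contraTneq K_large => ->; rewrite expr0 mulr1 -ltNge.
apply: le_lt_trans (exprn_ile1 2 (ltW eps_gt0) eps_le1) _.
by have := exprn_ege1 2 (ltW lam_gt1); lra.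
Qed.

Local Notation err u v := (eps * (d s u + d s v)).

Lemma centre_neq_scale k u v :
  centre k u != centre k v -> scale k < 2 * (d s u + d s v).
Proof.
apply: contraNlt => le_scale.
have := town_dist_le s d_pm u; have := town_dist_le s d_pm v.
by have := d_ge0 s u; have := d_ge0 s v => ? ? ? ?; rewrite !centre_near//; lra.
Qed.

Lemma detour_first_level u v : u != s ->
  centre (first_level u) u = centre (first_level u) v ->
  detour d (err u v) u v (centre (first_level u) u).
Proof.
move=> u_ns eq_uv; rewrite /detour; set k := first_level u in eq_uv *.
have := centre_dist_le k u; have := centre_dist_le k v; rewrite -eq_uv (dC _ u).
have : eps * town_dist u <= 2 * (eps * d s u).
  by rewrite mulrCA ler_pM2l// town_dist_le.
have := first_level_le u_ns; rewrite -/k; have := d_ge0 u v.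
have := mulr_ge0 (ltW eps_gt0) (d_ge0 s v); rewrite mulrDr; lra.
Qed.

Lemma detour_above_window k u v : centre k u != centre k v ->
  (first_level u + K <= k.+1)%N -> detour d (err u v) u v s.
Proof.
move=> /centre_neq_scale lt_scale le_k; set a := scale (first_level u).
have a_gt0 : 0 < a := scale_gt0 (first_level u).
have le_scale : lam ^+ K * a <= lam * scale k.
  by rewrite -scaleS mulrC (le_trans _ (scale_le le_k))// /scale exprD mulrA.
have le_a : 64 * (lam * a) <= eps ^+ 2 * scale k.
  rewrite -(ler_pM2l lam_gt0) [leRHS]mulrCA.
  apply: le_trans (ler_wpM2l (exprn_ge0 2 (ltW eps_gt0)) le_scale).
  rewrite [leRHS]mulrA; apply: le_trans (ler_wpM2r (ltW a_gt0) K_large).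
  by rewrite expr2; lra.
have : eps * (2 * d s u) <= eps * err u v.
  have := first_level_gt u; rewrite -/a.
  have := ler_wpM2l (ltW eps_gt0) (le_town_dist s d_pm u).
  have : eps ^+ 2 * scale k <= eps ^+ 2 * (2 * (d s u + d s v)).
    by rewrite ler_pM2l ?exprn_gt0// ltW.
  by rewrite [eps * err _ _]mulrA -expr2; lra.
rewrite ler_pM2l// /detour; have := d_triangle s u v; rewrite (dC u s); lra.
Qed.

Lemma centre_neq_ltn i j u v :
  centre i u != centre i v -> centre j u = centre j v -> (i < j)%N.
Proof.
move=> neq_i eq_j; rewrite ltnNge; apply: contra neq_i => le_ji; apply/eqP.
exact: (rep_le centreS) eq_j.
Qed.

Lemma exists_split_level i u v : centre i u != centre i v -> exists k,
  [/\ (k < top_level)%N, centre k u != centre k v &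
      centre k.+1 u = centre k.+1 v].
Proof.
move=> neq_i; have eq_top : centre top_level u == centre top_level v.
  by rewrite !centre_near// town_dist_le_top.
case: (ex_minnP (ex_intro (fun k => centre k u == centre k v) _ eq_top)).
move=> [/eqP /(centre_neq_ltn neq_i)//|k] /eqP eq_k k_min.
by exists k; split; rewrite ?k_min//; apply/negP => /k_min; rewrite ltnn.
Qed.

Section Portals.
Variable Q : nat -> X -> 'I_N -> X.
Hypothesis Q_centre : forall k x, exists l, Q k x l = x.
Hypothesis Q_portals : forall k x u v,
  d x u <= 4 * scale k -> d u v <= 4 * scale k ->
  same_town d x (4 * scale k / lam / 2) u v \/
  exists l, detour d (2 * (4 * scale k / lam ^+ J)) u v (Q k x l).

Lemma detour_portal k u v :
    centre k u != centre k v -> centre k.+1 u = centre k.+1 v ->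
  exists l, detour d (err u v) u v (Q k.+1 (centre k.+1 u) l).
Proof.
move=> neq_uv eq_uv; have sk_gt0 := scale_gt0 k; have sk1_gt0 := scale_gt0 k.+1.
set x := centre k.+1 u.
have xu : d x u <= 4 * scale k.+1.
  by have := centre_dist_le k.+1 u; rewrite -/x; lra.
have uv : d u v <= 4 * scale k.+1.
  have := d_triangle u x v; rewrite (dC u x).
  have := centre_dist_le k.+1 u; have := centre_dist_le k.+1 v.
  by rewrite -eq_uv -/x; lra.
have [uv_town|[l lP]] := Q_portals xu uv; last first.
  exists l; apply: le_trans lP _; rewrite lerD2l scaleS.
  have := J_large; have : 0 < lam ^+ J by rewrite exprn_gt0.
  move: (lam ^+ J) => L L_gt0 /(ler_wpM2r (ltW sk_gt0)) le_J.
  rewrite [leLHS]mulrA ler_pdivrMr//.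
  have := centre_neq_scale neq_uv.
  by rewrite -(ltr_pM2l (mulr_gt0 eps_gt0 L_gt0)); lra.
case/eqP: neq_uv; apply: centre_same.
have sigmaE : 4 * scale k.+1 / lam / 2 = 2 * scale k.
  by rewrite scaleS [4 * _]mulrCA [_ / lam]mulrC mulKf ?gt_eqF//; lra.
rewrite sigmaE in uv_town.
have [u_near|/centre_far u_town] := leP (town_dist u) (scale k.+1).
  by rewrite /x centre_near in uv_town.
exact: (same_town_recentre d_pm u_town).
Qed.

Local Notation tree := (level_tree top_level.+1 centre).

Local Notation node_at := (level_node top_level.+1 centre).

Definition first_node (u : X) : tree := node_at (first_level u) u.

Definition level_portal (w : tree * 'I_N) : X :=
  if w.1 is Some (i, x) then Q i x w.2 else s.

Lemma mem_window_first_node k u l :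
  (first_level u <= k)%N -> (k < first_level u + K)%N ->
  (node_at k u, l) \in window N K (first_node u).
Proof.
move=> le_k lt_k; apply/windowP; exists (k - first_level u)%N => /=.
  by rewrite ltn_psubLR ?window_gt0.
by rewrite iter_level_parent ?subnK//; exact: centreS.
Qed.

Lemma routed_at_level k u v l :
    (first_level u <= k < first_level u + K)%N ->
    (first_level v <= k < first_level v + K)%N ->
    (k <= top_level)%N -> centre k u = centre k v ->
    detour d (err u v) u v (Q k (centre k u) l) ->
  routed d s eps K first_node level_portal u v.
Proof.
move=> /andP[le_u lt_u] /andP[le_v lt_v] le_top eq_uv uv_l; right.
exists (node_at k u, l); split.
- exact: mem_window_first_node.
- have -> : node_at k u = node_at k v.
    by rewrite /level_node eq_uv.
  exact: mem_window_first_node.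
- by rewrite /level_portal /= level_nodeE.
Qed.

Lemma hierarchy_routed u v : u != s -> v != s ->
  routed d s eps K first_node level_portal u v.
Proof.
move=> u_ns v_ns.
have [eq_u|neq_u] :=
  eqVneq (centre (first_level u) u) (centre (first_level u) v).
  have [l lE] := Q_centre (first_level u) (centre (first_level u) u).
  have first_v := first_level_eq u_ns eq_u.
  have in_window : (first_level u <= first_level u < first_level u + K)%N.
    by rewrite leqnn -[ltnLHS]addn0 ltn_add2l window_gt0.
  apply: (routed_at_level (l := l) in_window); rewrite -?first_v//.
  - exact: ltnW (first_level_lt_top u_ns).
  - by rewrite lE; exact: detour_first_level.
have neq_v : centre (first_level v) u != centre (first_level v) v.
  apply: contra neq_u => /eqP/esym eq_v.
  by rewrite -(first_level_eq v_ns eq_v) eq_v.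
have [k [lt_top neq_k eq_k]] := exists_split_level neq_u.
have lt_u := centre_neq_ltn neq_u eq_k; have lt_v := centre_neq_ltn neq_v eq_k.
have [above_u|below_u] := leqP (first_level u + K) k.+1.
  by left; exact: detour_above_window neq_k above_u.
have [above_v|below_v] := leqP (first_level v + K) k.+1.
  left; apply: detour_sym => //; rewrite addrC.
  by apply: detour_above_window above_v; rewrite eq_sym.
have [l lP] := detour_portal neq_k eq_k.
by apply: routed_at_level lP; rewrite // ltnW.
Qed.

End Portals.

Lemma exists_routing :
  exists (T : rooted_tree) (leaf : X -> T) (Q : T * 'I_N -> X),
  forall u v, u != s -> v != s -> routed d s eps K leaf Q u v.
Proof.
have /choice[Q QP] (kx : nat * X) := exists_portals d_pm lam_gt1 d_hubs J kx.2
  (mulr_gt0 (ltr0Sn R 3) (scale_gt0 kx.1)).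
exists (level_tree top_level.+1 centre), first_node.
exists (level_portal (fun k x => Q (k, x))); apply: hierarchy_routed => k x.
  by case: (QP (k, x)).
by case: (QP (k, x)).
Qed.

End Hierarchy.

(** * The portal graph *)

Section PortalGraph.
Variables (R : realType) (G : wgraph R) (s : G) (T : rooted_tree) (N K : nat).
Variables (leaf : G -> T) (Q : T * 'I_N -> G) (e : R).
Hypothesis e_gt0 : 0 < e.

Local Notation reachable := (connect (@edge R G) s).

Definition spoke (u v : G) : bool :=
  [&& (u == s) (+) (v == s), reachable u & reachable v].

Definition portal_link (u : G) (w : T * 'I_N) : bool :=
  [&& u != s, reachable u & w \in window N K (leaf u)].

Definition portal_edge (a b : G + T * 'I_N) : bool :=
  match a, b with
  | inl u, inl v => spoke u v
  | inl u, inr w | inr w, inl u => portal_link u w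
  | inr _, inr _ => false
  end.

(* The term e d(s, u) keeps the edge from u to a portal copy of u itself at
   positive length. *)
Definition portal_link_len (u : G) (w : T * 'I_N) : R :=
  fdist u (Q w) + e * fdist s u.

Definition portal_len (a b : G + T * 'I_N) : R :=
  match a, b with
  | inl u, inl v => fdist u v
  | inl u, inr w | inr w, inl u => portal_link_len u w
  | inr _, inr _ => 0
  end.

Lemma spoke_sym : symmetric spoke.
Proof. by move=> u v; rewrite /spoke addbC; congr (_ && _); rewrite andbC. Qed.

Lemma portal_edge_sym : symmetric portal_edge.
Proof. by move=> [u|w] [v|w'] //=; exact: spoke_sym. Qed.

Lemma portal_edge_irr : irreflexive portal_edge.
Proof. by move=> [u|w] //=; rewrite /spoke addbb. Qed.

Lemma portal_len_sym a b : portal_len a b = portal_len b a.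
Proof. by case: a b => [u|w] [v|w'] //=; exact: fdistC. Qed.

Lemma portal_len_gt0 a b : portal_edge a b -> 0 < portal_len a b.
Proof.
have link_gt0 u w : portal_link u w -> 0 < portal_link_len u w.
  move=> /and3P[u_ns su _]; rewrite ltr_wpDl ?fdist_ge0// mulr_gt0//.
  by rewrite fdist_gt0// eq_sym.
case: a b => [u|w] [v|w'] //=; [|exact: link_gt0..].
move=> /and3P[neq su sv]; apply: fdist_gt0; last first.
  exact: connect_common_source su sv.
by apply: contraTneq neq => ->; rewrite addbb.
Qed.

Definition portal_graph : wgraph R :=
  WGraph portal_edge_sym portal_edge_irr portal_len_sym portal_len_gt0.

Definition node_bag (t : T) : {set portal_graph} :=
  inl s |: inr @: window N K t.

Definition portal_bag (t : attach_leaves leaf) : {set portal_graph} :=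
  match t with inl t => node_bag t | inr u => inl u |: node_bag (leaf u) end.

Definition portal_top (a : portal_graph) : attach_leaves leaf :=
  match a with
  | inl u => if u == s then inl (apex T) else inr u
  | inr w => inl w.1
  end.

Lemma mem_node_bag_inl t u : (inl u \in node_bag t) = (u == s).
Proof.
by rewrite in_setU1 orbC; case: imsetP => [[]//|_]; apply/eqP/eqP => [[]|->].
Qed.

Lemma mem_node_bag_inr t w : (inr w \in node_bag t) = (w \in window N K t).
Proof. by rewrite in_setU1 mem_imset// => w1 w2 []. Qed.

Lemma card_node_bag t : (#|node_bag t| <= (K * N).+1)%N.
Proof.
rewrite cardsU1 -add1n leq_add ?leq_b1// (leq_trans (leq_imset_card _ _))//.
exact: card_window.
Qed.

Lemma mem_portal_top a : (0 < K)%N -> a \in portal_bag (portal_top a).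
Proof.
move=> K_gt0; case: a => [u|w] /=.
  by have [->|u_ns] := eqVneq u s; rewrite /= ?mem_node_bag_inl// setU11.
by rewrite mem_node_bag_inr; apply/windowP; exists 0%N.
Qed.

Lemma mem_portal_bag_parent a t : a \in portal_bag t -> t != portal_top a ->
  t != apex (attach_leaves leaf) /\ a \in portal_bag (parent t).
Proof.
case: t a => [t|v] [u|w] /=.
- rewrite mem_node_bag_inl => /eqP ->; rewrite eqxx => t_napex; split=> //.
  by rewrite mem_node_bag_inl.
- rewrite !mem_node_bag_inr => w_t t_nw; rewrite eq_sym in t_nw.
  by have [] := window_parent w_t t_nw.
- rewrite in_setU1 !mem_node_bag_inl => /predU1P[[->]|->]; last by [].
  by case: ifP => [//|_]; rewrite eqxx.
- by rewrite in_setU1 mem_node_bag_inr => /orP[/eqP|].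
Qed.

Lemma portal_edge_bag (a b : portal_graph) : edge a b ->
  exists t, (a \in portal_bag t) && (b \in portal_bag t).
Proof.
have self u : inl u \in portal_bag (inr u) by rewrite setU11.
have link u w : portal_link u w -> inr w \in portal_bag (inr u).
  by move=> /and3P[_ _ w_u]; rewrite /= in_setU1 mem_node_bag_inr w_u orbT.
have centre_in u : inl s \in portal_bag (inr u).
  by rewrite /= in_setU1 mem_node_bag_inl eqxx orbT.
case: a b => [u|w] [v|w'] //=; last 2 first.
- by exists (inr u); rewrite self link.
- by exists (inr v); rewrite self link.
rewrite /spoke; have [->|_] := eqVneq u s.
  by exists (inr v); rewrite self centre_in.
by have [->|] := eqVneq v s => // _; exists (inr u); rewrite self centre_in.
Qed.

Lemma treewidth_portal_graph :
  (0 < K)%N -> (treewidth portal_graph <= K * N + 1)%N.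
Proof.
move=> K_gt0; apply: (@treewidth_le_bags _ _ _ portal_bag portal_top).
- by move=> a; exact: mem_portal_top.
- exact: mem_portal_bag_parent.
- exact: portal_edge_bag.
move=> [t|u]; rewrite addn1 /=; first exact/leqW/card_node_bag.
by rewrite cardsU1 -add1n leq_add ?leq_b1// card_node_bag.
Qed.

Hypothesis Q_reachable : forall w, reachable (Q w).

Definition portal_proj (a : portal_graph) : G :=
  match a with inl u => u | inr w => Q w end.

Lemma dist_le_portal_dist (a b : portal_graph) :
  (dist (portal_proj a) (portal_proj b) <= dist a b)%E.
Proof.
apply: dist_le_map a b => a b.
have link_le u w :
    portal_link u w -> (dist u (Q w) <= (portal_link_len u w)%:E)%E.
  move=> /and3P[_ su _].
  rewrite (fdistE (connect_common_source su (Q_reachable w))) lee_fin lerDl.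
  by rewrite mulr_ge0 ?fdist_ge0// ltW.
case: a b => [u|w] [v|w'] //=; last 2 first.
- exact: link_le.
- by rewrite dist_sym; exact: link_le.
by move=> /and3P[_ su sv]; rewrite (fdistE (connect_common_source su sv)).
Qed.

Lemma portal_dist_detour (u v p : portal_graph) :
  edge u p -> edge p v -> (dist u v <= (len u p + len p v)%:E)%E.
Proof.
move=> up pv; rewrite EFinD; apply: le_trans (dist_triangle u p v) _.
by apply: leeD; exact: dist_le_edge.
Qed.

Hypothesis G_routed : forall u v, reachable u -> reachable v ->
  u != s -> v != s -> routed (@fdist R G) s e K leaf Q u v.

Lemma portal_fdist_le u v : reachable u -> reachable v ->
  (dist (inl u : portal_graph) (inl v)
     <= (fdist u v + 2 * e * (fdist s u + fdist s v))%:E)%E.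
Proof.
move=> su sv; have err_ge0 : 0 <= e * (fdist s u + fdist s v).
  by rewrite mulr_ge0 ?addr_ge0 ?fdist_ge0// ltW.
have [->|u_nv] := eqVneq u v.
  by rewrite distxx lee_fin addr_ge0 ?mulr_ge0 ?addr_ge0 ?fdist_ge0 ?ltW.
have [uv_spoke|] := boolP ((u == s) (+) (v == s)).
  have uv : edge (inl u : portal_graph) (inl v).
    by rewrite /= /spoke uv_spoke su sv.
  by apply: le_trans (dist_le_edge uv) _; rewrite lee_fin /=; lra.
have [us|u_ns] := eqVneq u s; first by rewrite -us eq_sym (negbTE u_nv).
have [//|v_ns _] := eqVneq v s.
have [via_s|[w [w_u w_v via_w]]] := G_routed su sv u_ns v_ns.
  have us : edge (inl u : portal_graph) (inl s).
    by rewrite /= /spoke eqxx (negbTE u_ns) su connect0.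
  have sv' : edge (inl s : portal_graph) (inl v).
    by rewrite /= /spoke eqxx (negbTE v_ns) sv connect0.
  apply: le_trans (portal_dist_detour us sv') _; rewrite lee_fin /=.
  by move: via_s; rewrite /detour; lra.
have uw : edge (inl u : portal_graph) (inr w).
  by rewrite /= /portal_link u_ns su.
have wv : edge (inr w : portal_graph) (inl v).
  by rewrite /= /portal_link v_ns sv.
apply: le_trans (portal_dist_detour uw wv) _; rewrite lee_fin /=.
by move: via_w; rewrite /portal_link_len /detour (fdistC (Q w)); lra.
Qed.

Lemma portal_dist_le u v :
  (dist (inl u : portal_graph) (inl v)
     <= dist u v + (2 * e)%:E * (dist s u + dist s v))%E.
Proof.
have e2_gt0 : (0 < (2 * e)%:E)%E by rewrite lte_fin mulr_gt0.
have [su|/dist_pinfty ->] := boolP (reachable u); last first.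
  by rewrite addye ?dist_neqNy// gt0_muley// addey ?leey ?dist_neqNy.
have [sv|/dist_pinfty ->] := boolP (reachable v); last first.
  by rewrite addey ?dist_neqNy// gt0_muley// addey ?leey ?dist_neqNy.
rewrite (fdistE (connect_common_source su sv)) (fdistE su) (fdistE sv).
rewrite -(EFinD (fdist s u)) -EFinM -EFinD.
exact: portal_fdist_le.
Qed.

End PortalGraph.

(** * Highway dimension *)

Section Component.
Variables (R : realType) (G : wgraph R) (s : G).

Definition component : finType := {u : G | connect (@edge R G) s u}.

Definition component_source : component := Sub s (connect0 _ s).

Definition component_dist (x y : component) : R := fdist (val x) (val y).

Lemma component_distE (x y : component) :
  dist (val x) (val y) = (component_dist x y)%:E.
Proof. by rewrite fdistE// (connect_common_source (valP x) (valP y)). Qed.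

Lemma component_dist_gt0 x :
  x != component_source -> 0 < component_dist component_source x.
Proof.
by move=> x_ns; rewrite fdist_gt0 ?(valP x)// val_eqE eq_sym.
Qed.

Lemma pseudometric_component_dist : pseudometric component_dist.
Proof.
split=> [x|x y|x y z].
- by rewrite /component_dist /fdist distxx.
- exact: fdistC.
- by rewrite -lee_fin EFinD -!component_distE dist_triangle.
Qed.

Lemma component_between_path (a b : component) p (w : G) :
    is_shortest_path (val a) (val b) p -> w \in val a :: p ->
  exists2 x : component, val x = w & between component_dist a b x.
Proof.
move=> p_shortest w_p; have le_w := dist_shortest_path p_shortest w_p.
have sw : connect (@edge R G) s w.
  apply: connect_trans (valP a) _; rewrite -dist_fin_numE.
  rewrite ge0_fin_numE ?dist_ge0//.
  apply: le_lt_trans (ltry (component_dist a b)).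
  by rewrite -component_distE (le_trans _ le_w)// leeDl ?dist_ge0.
exists (Sub w sw : component) => //; apply/eqP; rewrite eq_le.
rewrite (pseudometric_triangle pseudometric_component_dist) andbT.
by rewrite -lee_fin EFinD -!component_distE.
Qed.

Lemma hub_bound_component (c : R) (eta : nat) :
  highway_bound G c eta -> hub_bound component_dist c eta.
Proof.
move=> G_hubs h r r_gt0; have [S [_ S_le S_hit]] := G_hubs r (val h) r_gt0.
exists [set x | val x \in S].
  apply: leq_trans S_le; rewrite -(card_imset _ val_inj).
  apply: subset_leq_card; apply/fintype.subsetP => _ /imsetP[x + ->].
  by rewrite inE.
move=> a b le_ab ball_ab.
have [p p_shortest] := dist_attained (connect_common_source (valP a) (valP b)).
have [||w wS w_p] := S_hit _ _ _ p_shortest.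
- move=> w /(component_between_path p_shortest)[x <- /ball_ab].
  by rewrite inE component_distE lee_fin.
- by rewrite -lee_fin (proj2 p_shortest) component_distE lee_fin.
- have [x xw abx] := component_between_path p_shortest w_p.
  by exists x; rewrite ?inE ?xw.
Qed.

End Component.

Section TreewidthBound.
Variable R : realType.
Implicit Types lam e : R.

Definition refinement_depth lam e : nat := (trunc_logr lam (16 * lam / e)).+1.

Definition window_size lam e : nat :=
  (trunc_logr lam (64 * lam ^+ 2 / e ^+ 2)).+1.

Lemma refinement_depth_le lam e : 1 < lam -> 0 < e ->
  16 * lam <= e * lam ^+ refinement_depth lam e.
Proof.
move=> lam_gt1 e_gt0.
by rewrite [leRHS]mulrC -ler_pdivrMr// ltW ?trunc_logr_ltn.
Qed.

Lemma window_size_le lam e : 1 < lam -> 0 < e ->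
  64 * lam ^+ 2 <= e ^+ 2 * lam ^+ window_size lam e.
Proof.
move=> lam_gt1 e_gt0.
by rewrite [leRHS]mulrC -ler_pdivrMr ?exprn_gt0// ltW ?trunc_logr_ltn.
Qed.

Definition treewidth_bound lam e (eta : nat) : nat :=
  (window_size lam e * eta.+1 ^ refinement_depth lam e + 1)%N.

End TreewidthBound.

Lemma highway_embedding (R : realType) (c e : R) (eta : nat) (G : wgraph R)
    (s : G) :
    4 < c -> 0 < e <= 1 -> highway_bound G c eta ->
  exists (H : wgraph R) (phi : G -> H),
    [/\ injective phi, (treewidth H <= treewidth_bound (c / 4) e eta)%N &
        forall u v : G,
          (dist u v <= dist (phi u) (phi v))%E /\
          (dist (phi u) (phi v)
             <= dist u v + (2 * e)%:E * (dist s u + dist s v))%E].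
Proof.
move=> c_gt4 /andP[e_gt0 e_le1] /hub_bound_component-/(_ s) G_hubs.
have lam_gt1 : 1 < c / 4 by lra.
have cE : c = 4 * (c / 4) by lra.
rewrite [X in hub_bound _ X]cE in G_hubs.
have [T [leaf [Q Q_routed]]] := exists_routing (pseudometric_component_dist s)
  (@component_dist_gt0 _ G s) lam_gt1 G_hubs e_gt0 e_le1
  (refinement_depth_le lam_gt1 e_gt0) (window_size_le lam_gt1 e_gt0).
pose leafG (u : G) := oapp leaf (apex T) (insub u).
exists (portal_graph s (window_size (c / 4) e) leafG (val \o Q) e_gt0), inl.
split=> [u v []//||u v]; first exact: treewidth_portal_graph.
split.
  by apply: (dist_le_portal_dist _ (inl u) (inl v)) => w; exact: valP.
apply: portal_dist_le => {u v} u v su sv u_ns v_ns.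
have leafE w (sw : connect (@edge R G) s w) : leafG w = leaf (Sub w sw).
  by rewrite /leafG insubT.
rewrite /routed !leafE.
exact: (Q_routed (Sub u su) (Sub v sv)).
Qed.

Theorem theorem3 (R : realType) (c : R) (hc : 4 < c) :
  exists f : R -> nat -> nat,
    forall (eps : R) (eta : nat) (G : wgraph R) (s : G),
      0 < eps -> highway_dim G c = eta ->
      exists (H : wgraph R) (phi : G -> H),
        [/\ injective phi,
            (treewidth H <= f eps eta)%N &
            forall u v : G,
              (dist u v <= dist (phi u) (phi v))%E /\
              (dist (phi u) (phi v)
                 <= dist u v + eps%:E * (dist s u + dist s v))%E].
Proof.
exists (fun eps => treewidth_bound (c / 4) (Num.min eps 1 / 2)).
move=> eps eta G s eps_gt0 dimE; set e := Num.min eps 1 / 2.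
have e_gt0 : 0 < e by rewrite divr_gt0// lt_min eps_gt0 ltr01.
have e_le1 : e <= 1.
  by rewrite ler_pdivrMr// mul1r (@le_trans _ _ 1) ?ge_min ?lexx ?orbT// ler1n.
have G_bound : highway_bound G c eta.
  by rewrite -dimE /highway_dim; case: ex_minnP => k /asboolP.
have e_itv : 0 < e <= 1 by rewrite e_gt0.
have [H [phi [phi_inj tw_H phi_dist]]] := highway_embedding s hc e_itv G_bound.
exists H, phi; split=> // u v; have [le_uv uv_le] := phi_dist u v; split=> //.
apply: le_trans uv_le _.
rewrite leeD2l// lee_wpmul2r ?adde_ge0 ?dist_ge0// lee_fin.
by rewrite /e mulrC divfK// ge_min lexx.
Qed.
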